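(* Let $k$ be a field and let $I\subset k[\mathbf{y}]=k[y_1,\ldots,y_n]$ be a monomial ideal with $\hat L\cong LCM(I)$. If $I$ has a linear resolution, then so does the squarefree minimal ideal $M(L)\subset k[L]$.
   Context: For a monomial ideal $I$ with minimal monomial generators $f_1,\ldots,f_r$, $LCM(I)$ is the set of least common multiples of all subsets of $\{f_1,\ldots,f_r\}$ (the empty subset giving $1$), ordered by divisibility; it is a finite atomic lattice. For a finite atomic lattice $\hat L$ (every element is a join of atoms) with minimum $\hat 0$ and maximum $\hat 1$: $L=\hat L\setminus\{\hat 0,\hat 1\}$; $\operatorname{mi}(L)$ is the set of meet-irreducible elements of $L$, i.e. elements of $L$ covered by exactly one element of $\hat L$; $k[L]:=k[x_l: l\in\operatorname{mi}(L)]$; for $a\in\hat L$, $x(a):=\prod x_l$ over $l\in\operatorname{mi}(L)$ with $a\not\le l$; and $M(L):=(x(a): a\text{ an atom of }\hat L)$. A graded ideal $I$ has a linear resolution if there is $d$ such that the graded Betti numbers satisfy $\beta_{i,j}(I)=0$ unless $j=i+d$ (standard grading). *)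

(* Defs.v *)
From mathcomp Require Import all_boot all_order all_algebra.
From mathcomp Require Export mpoly.
Set Implicit Arguments.
Unset Strict Implicit.
Unset Printing Implicit Defensive.
Import Order.TTheory GRing.Theory.
Local Open Scope ring_scope.

Definition ideal_span (k : fieldType) (n : nat) (G : {mpoly k[n]} -> Prop)
    (p : {mpoly k[n]}) : Prop :=
  exists s : seq ({mpoly k[n]} * {mpoly k[n]}),
    (forall c, c \in s -> G c.2) /\ p = \sum_(c <- s) c.1 * c.2.

Definition is_monomial_ideal (k : fieldType) (n : nat)
    (I : {mpoly k[n]} -> Prop) : Prop :=
  exists A : 'X_{1..n} -> Prop,
    forall p, I p <-> ideal_span (fun q => exists2 m, A m & q = 'X_[m]) p.

Definition min_monomial_gen (k : fieldType) (n : nat)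
    (I : {mpoly k[n]} -> Prop) (m : 'X_{1..n}) : Prop :=
  I 'X_[m] /\ forall m', (m' <= m)%MM -> I 'X_[m'] -> m' = m.

(* [(_ <= _)%MM] is divisibility of monomials; finite subsets of the (finite,
   by Dickson's lemma) set of minimal generators are given as sequences. *)
Definition LCM (k : fieldType) (n : nat) (I : {mpoly k[n]} -> Prop)
    (m : 'X_{1..n}) : Prop :=
  exists s : seq 'X_{1..n},
    (forall f, f \in s -> min_monomial_gen I f) /\
    m = \big[@mlcm n/0%MM]_(f <- s) f.

(* [... -> S^(rk 1) -> S^(rk 0) -> S] over S = k[y_1, ..., y_n]. Elements of
   S^(rk i) are row vectors and the maps act by right multiplication; the
   basis vector number [a] of S^(rk i) has degree [gdeg i a]. *)
Record graded_free_seq (k : fieldType) (n : nat) := GradedFreeSeq {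
  rk : nat -> nat;
  gdeg : forall i, 'I_(rk i) -> nat;
  aug : 'cV[{mpoly k[n]}]_(rk 0);
  dif : forall i, 'M[{mpoly k[n]}]_(rk i.+1, rk i)
}.

(* Degree-preserving maps: entry (a, b) is homogeneous of degree
   gdeg a - gdeg b, hence zero when that difference is negative. *)
Definition graded_maps (k : fieldType) (n : nat) (F : graded_free_seq k n) :
    Prop :=
  (forall a : 'I_(rk F 0), aug F a ord0 \is (gdeg a).-homog) /\
  (forall i (a : 'I_(rk F i.+1)) (b : 'I_(rk F i)),
     if (gdeg b <= gdeg a)%N then dif F i a b \is (gdeg a - gdeg b).-homog
     else dif F i a b == 0).

Definition is_graded_free_resolution (k : fieldType) (n : nat)
    (I : {mpoly k[n]} -> Prop) (F : graded_free_seq k n) : Prop :=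
  [/\ graded_maps F,
      forall p, I p <-> exists v : 'rV_(rk F 0), p%:M = v *m aug F,
      forall v : 'rV_(rk F 0),
        v *m aug F = 0 <-> exists w : 'rV_(rk F 1), v = w *m dif F 0
    & forall i (v : 'rV_(rk F i.+1)),
        v *m dif F i = 0 <-> exists w : 'rV_(rk F i.+2), v = w *m dif F i.+1].

Section Betti.
Variables (k : fieldType) (n : nat).
Implicit Type F : graded_free_seq k n.

(* The differential of F tensored with k = S / (y_1, ..., y_n). *)
Definition dif_k F (i : nat) : 'M[k]_(rk F i.+1, rk F i) :=
  map_mx (fun p : {mpoly k[n]} => p@_0%MM) (dif F i).

(* Its row space is the degree j part of F_i tensored with k. *)
Definition degree_part F (i j : nat) : 'M[k]_(rk F i) :=
  diag_mx (\row_a (gdeg a == j)%:R).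

Definition cycles F (i j : nat) : 'M[k]_(rk F i) :=
  match i return 'M[k]_(rk F i) with
  | 0 => degree_part F 0 j
  | i'.+1 => (degree_part F i'.+1 j :&: kermx (dif_k F i'))%MS
  end.

Definition boundaries F (i j : nat) : 'M[k]_(rk F i.+1, rk F i) :=
  degree_part F i.+1 j *m dif_k F i.

(* The dimension of the degree j part of H_i(F tensored with k). *)
Definition tor_dim F (i j : nat) : nat :=
  (\rank (cycles F i j) - \rank (boundaries F i j))%N.

(* [graded_betti I i j b] says beta_{i,j}(I) = dim_k Tor_i(I, k)_j = b; Tor may
   be computed from any graded free resolution of I. *)
Definition graded_betti (I : {mpoly k[n]} -> Prop) (i j b : nat) : Prop :=
  exists2 F, is_graded_free_resolution I F & tor_dim F i j = b.

Definition has_linear_resolution (I : {mpoly k[n]} -> Prop) : Prop :=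
  exists d : nat, forall i j : nat, j != (i + d)%N -> graded_betti I i j 0.

End Betti.

Section Lattice.
Context {disp : Order.disp_t} (L : finTBLatticeType disp).

Definition covers (x y : L) : bool :=
  (x < y)%O && [forall z : L, ~~ (x < z < y)%O].

Definition atom (a : L) : bool := covers \bot%O a.

Definition is_atomic : Prop :=
  forall x : L, exists A : {set L},
    {in A, forall a, atom a} /\ x = (\join_(a in A) a)%O.

Definition mi : {set L} :=
  [set l | [&& l != \bot%O, l != \top%O & #|[set y | covers l y]| == 1%N]].

(* k[L] is [{mpoly k[#|mi|]}]; the variable x_l is ['X_i] for l = enum_val i. *)
Definition xmon (k : fieldType) (a : L) : {mpoly k[#|mi|]} :=
  \prod_(i < #|mi| | ~~ (a <= enum_val i)%O) 'X_i.

Definition minimal_ideal (k : fieldType) : {mpoly k[#|mi|]} -> Prop :=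
  ideal_span (fun q => exists2 a, atom a & q = xmon k a).

Definition isomorphic_to_LCM (k : fieldType) (n : nat)
    (I : {mpoly k[n]} -> Prop) : Prop :=
  exists f : L -> 'X_{1..n},
    (forall x y, (f x <= f y)%MM = (x <= y)%O) /\
    (forall m, LCM I m <-> exists x, f x = m).

End Lattice.

(* Main.v *)
Require Import Defs.
From mathcomp Require Import all_boot all_order all_algebra.
From Stdlib Require Classical_Prop.
Set Implicit Arguments.
Unset Strict Implicit.
Unset Printing Implicit Defensive.
Import Order.TTheory GRing.Theory.
Local Open Scope ring_scope.

(* Resolve both ideals by Taylor-type complexes on the atoms of L. Tensored with
   k, each splits over y in L into the same complexes C(y), spanned by the tuples
   of atoms with join y; C(y) sits in degree deg f(y) for I, where f embeds L as
   LCM(I), and in degree e(y) := #{l in mi : not y <= l} for M(L). As Tor does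
   not depend on the resolution, linearity of I says that H_i(C(y)) = 0 unless
   deg f(y) = i + d. If H_{i+1}(C(y)) <> 0, filtering the boundary of the full
   simplex on the atoms below y gives z < y with H_i(C(z)) <> 0; then f(y)/f(z) is
   a single variable, which forces exactly one meet-irreducible l to satisfy
   z <= l and not y <= l, so e(y) = e(z) + 1. It remains to see that e is constant
   on atoms: otherwise take atoms a, b with e(a) <> e(b) and minimal join y; then
   H_1(C(y)) <> 0, and the previous step for a < y and b < y gives e(a) = e(b). *)

(** * Ordered simplicial chains and the cone contraction *)

Section OrderedChains.
Variables (k : comNzRingType) (A : finType).

(** The coefficient of [t] in the alternating sum of the faces of [s], where deleting entry [i],
    counted from 0, has sign (-1)^i. *)
Fixpoint incidence (s t : seq A) : k :=
  if s is a :: s' then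
    (s' == t)%:R -
    (if t is b :: t' then (a == b)%:R * incidence s' t' else 0)
  else 0.

Definition bd p (z : p.+1.-tuple A -> k) (t : p.-tuple A) : k :=
  \sum_s z s * incidence s t.

Definition cone p (a : A) (z : p.-tuple A -> k) (s : p.+1.-tuple A) : k :=
  (thead s == a)%:R * z (behead_tuple s).

Lemma big_tuple_cons (R : nmodType) p (F : p.+1.-tuple A -> R) :
  \sum_s F s = \sum_a \sum_(t : p.-tuple A) F (cons_tuple a t).
Proof.
rewrite pair_bigA /=.
rewrite (reindex (fun x : A * p.-tuple A => cons_tuple x.1 x.2)) //=.
exists (fun s : p.+1.-tuple A => (thead s, behead_tuple s)) => [[a t] | s] _ /=.
  by rewrite theadE; congr pair; apply: val_inj.
by apply: val_inj; rewrite /= [in RHS](tuple_eta s).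
Qed.

Lemma incidence_subset s t : incidence s t != 0 -> {subset t <= s}.
Proof.
elim: s t => [|a s IHs] t /=; first by rewrite eqxx.
have [<- _ x xs | _] := eqVneq s t; first by rewrite inE xs orbT.
case: t => [|b t]; first by rewrite subr0 eqxx.
rewrite sub0r oppr_eq0; have [<-|_] := eqVneq a b; last by rewrite mul0r eqxx.
by rewrite mul1r => /IHs st x; rewrite !inE => /orP[-> //|/st ->]; rewrite orbT.
Qed.

Lemma sum_eq_tuple p (R : pzRingType) (F : seq A -> R) (s : p.-tuple A) :
  \sum_(t : p.-tuple A) (val s == t)%:R * F t = F s.
Proof.
rewrite (bigD1 s) //= eqxx mul1r big1 ?addr0 // => t /negPf.
by rewrite eq_sym -val_eqE /= => ->; rewrite mul0r.
Qed.

(** Deleting the head before or after another entry gives opposite signs; the terms that keep the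
    head vanish by induction on the tail. *)
Lemma incidence_sq p (s : p.+2.-tuple A) (u : p.-tuple A) :
  \sum_(t : p.+1.-tuple A) incidence s t * incidence t u = 0.
Proof.
elim: p s u => [|p IHp] s u.
  case/tupleP: s => a s; rewrite (tuple0 u) big_tuple_cons exchange_big /=.
  rewrite (big_pred1 [tuple]) => [|t]; last exact/esym/eqP/tuple0.
  case/tupleP: s => b s /=; rewrite (tuple0 s) /=.
  under eq_bigr do rewrite /= subr0 mulr1 mulr1n mulr1 [in _ == _]/eq_op /= andbT.
  rewrite sumrB; apply/eqP; rewrite subr_eq0; apply/eqP.
  rewrite (bigD1 b) //= eqxx big1 => [|c /negPf]; last by rewrite eq_sym => ->.
  rewrite (bigD1 a) //= eqxx big1 => [//|c /negPf].
  by rewrite eq_sym => ->.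
case/tupleP: s => a s.
under eq_bigr => t _ do rewrite mulrBl.
rewrite sumrB (sum_eq_tuple (fun t => incidence t u)).
rewrite big_tuple_cons (bigD1 a) //= [X in _ - (_ + X)]big1 => [|b /negPf ba];
  last by rewrite big1 // => t _; rewrite eq_sym ba !mul0r.
under eq_bigr => t _ do rewrite eqxx mul1r /= mulrBr.
rewrite addr0 sumrB.
under eq_bigr => t _ do rewrite mulrC.
rewrite (eq_bigr (fun t : p.+1.-tuple A => (val u == t)%:R * incidence s t));
  last by move=> t _; rewrite eq_sym.
rewrite (sum_eq_tuple (fun t => incidence s t)) opprB addrCA subrr addr0.
case/tupleP: u => b u /=.
under eq_bigr => t _ do rewrite mulrCA.
by rewrite -mulr_sumr IHp mulr0.
Qed.

Lemma bd_bd p (z : p.+2.-tuple A -> k) u : bd (bd z) u = 0.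
Proof.
rewrite /bd; under eq_bigr => t _ do rewrite mulr_suml.
rewrite exchange_big big1 //= => s _.
under eq_bigr => t _ do rewrite -mulrA.
by rewrite -mulr_sumr incidence_sq mulr0.
Qed.

Lemma bd_cone p a (z : p.+1.-tuple A -> k) :
  bd z =1 (fun=> 0) -> bd (cone a z) =1 z.
Proof.
move=> z0 t; rewrite /bd big_tuple_cons (bigD1 a) //= [X in _ + X]big1; last first.
  by move=> b /negPf ba; rewrite big1 // => s _; rewrite /cone theadE ba !mul0r.
rewrite addr0 /cone.
have -> : \sum_(s : p.+1.-tuple A) (thead (cons_tuple a s) == a)%:R *
    z (behead_tuple (cons_tuple a s)) * incidence (cons_tuple a s) t =
   \sum_(s : p.+1.-tuple A) z s * incidence (a :: s) t.
  apply: eq_bigr => s _; rewrite theadE eqxx mul1r; congr (z _ * _).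
  exact: val_inj.
case/tupleP: t => b t /=.
under eq_bigr => s _ do rewrite mulrBr mulrCA.
rewrite sumrB -mulr_sumr -/(bd z t) z0 mulr0 subr0.
rewrite (bigD1 (cons_tuple b t)) //= eqxx mulr1 big1 ?addr0 => [|s /negPf].
  by congr z; apply: val_inj.
by rewrite -val_eqE /= => ->; rewrite mulr0.
Qed.

End OrderedChains.

(** * Homology of the complexes C(x) of tuples with a prescribed join *)

Section RelativeAcyclicity.
Variables (k : comNzRingType) (A : finType).
Context {disp : Order.disp_t} (L : finTBLatticeType disp) (v : A -> L).
Hypothesis v_neq0 : forall a, v a != \bot%O.

Definition join_seq (s : seq A) : L := (\join_(a <- s) v a)%O.

(** This is H_p(C(x)) = 0, with C(x) the chains on tuples of join at most [x] modulo those of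
    smaller join. Classes are represented by functions vanishing off join [x], and [bd] is read only
    at tuples with join [x]. *)
Definition relative_acyclic p (x : L) :=
  forall z : p.+1.-tuple A -> k,
    (forall s : p.+1.-tuple A, join_seq s != x -> z s = 0) ->
    (forall t : p.-tuple A, join_seq t = x -> bd z t = 0) ->
  exists2 w : p.+2.-tuple A -> k,
    forall s : p.+2.-tuple A, join_seq s != x -> w s = 0 &
    forall t : p.+1.-tuple A, join_seq t = x -> bd w t = z t.

Lemma le_join_seq s a : a \in s -> (v a <= join_seq s)%O.
Proof. by move=> sa; rewrite /join_seq (big_rem a) //= leUl. Qed.

Lemma join_seq_le s x :
  (join_seq s <= x)%O = all (fun a => (v a <= x)%O) s.
Proof.
rewrite /join_seq; elim: s => [|a s IHs]; first by rewrite big_nil le0x.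
by rewrite big_cons leUx IHs.
Qed.

Lemma join_seq_neq0 p (s : p.+1.-tuple A) : join_seq s != \bot%O.
Proof.
apply: contra (v_neq0 (thead s)); rewrite -!lex0; apply: le_trans.
exact/le_join_seq/mem_tnth.
Qed.

Lemma incidence_join s t :
  incidence k s t != 0 -> (join_seq t <= join_seq s)%O.
Proof.
move=> /incidence_subset st; rewrite join_seq_le.
by apply/allP => a /st; apply: le_join_seq.
Qed.

Lemma bdD p (z w : p.+1.-tuple A -> k) t :
  bd (fun s => z s + w s) t = bd z t + bd w t.
Proof. by rewrite /bd -big_split; apply: eq_bigr => s _; rewrite mulrDl. Qed.

Lemma bdB p (z w : p.+1.-tuple A -> k) t :
  bd (fun s => z s - w s) t = bd z t - bd w t.
Proof. by rewrite /bd -sumrB; apply: eq_bigr => s _; rewrite mulrBl. Qed.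

Lemma bd0 p t : bd (fun _ : p.+1.-tuple A => 0 : k) t = 0.
Proof. by rewrite /bd big1 // => s _; rewrite mul0r. Qed.

Lemma eq_bd_join p (z w : p.+1.-tuple A -> k) (t : p.-tuple A) :
  (forall s : p.+1.-tuple A, (join_seq t <= join_seq s)%O -> z s = w s) ->
  bd z t = bd w t.
Proof.
move=> zw; apply: eq_bigr => s _.
have [->|/incidence_join ts] := eqVneq (incidence k s t) 0; first by rewrite !mulr0.
by rewrite zw.
Qed.

Lemma set_maximal (U : {set L}) x : x \in U ->
  exists2 y, y \in U & forall z, z \in U -> ~~ (y < z)%O.
Proof.
move=> Ux; pose h (y : L) := #|[set z | (z <= y)%O]|.
have [y Uy ymax] := arg_maxnP h Ux; exists y => // z Uz; apply/negP => yz.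
have /= := ymax z Uz; rewrite leqNgt => /negP; apply; apply: proper_card.
apply/properP; split; last by exists z; rewrite !inE ?lexx // lt_geF.
by apply/subsetP => u; rewrite !inE => /le_trans; apply; apply: ltW.
Qed.

(** Induction on the size of [U], peeling off a maximal [y]: the part of [b] with join [y] is a
    relative cycle, and subtracting [bd] of a filling moves [b] to [U :\ y]. The condition on [bd b]
    leaves out just the empty tuple, the only one with join [\bot]. *)
Lemma down_set_acyclic p (U : {set L}) :
  \bot%O \notin U ->
  (forall y z, y \in U -> (z <= y)%O -> z != \bot%O -> z \in U) ->
  (forall y, y \in U -> relative_acyclic p y) ->
  forall b : p.+1.-tuple A -> k,
    (forall s : p.+1.-tuple A, join_seq s \notin U -> b s = 0) ->
    (forall t : p.-tuple A, join_seq t != \bot%O -> bd b t = 0) ->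
  exists2 w : p.+2.-tuple A -> k,
    forall s : p.+2.-tuple A, join_seq s \notin U -> w s = 0 & bd w =1 b.
Proof.
have [n] := ubnP #|U|; elim: n U => // n IHn U ltUn U0 Udown Uacy b bU db.
have [U00|[x0 Ux0]] := set_0Vmem U.
  exists (fun=> 0) => // t; rewrite bd0 bU //.
  by rewrite U00 inE.
have [y Uy ymax] := set_maximal Ux0.
have y0 : y != \bot%O by apply: contraNneq U0 => <-.
pose by_ (s : p.+1.-tuple A) := if join_seq s == y then b s else 0.
have [||wy wyy dwy] := Uacy y Uy by_.
- by move=> s; rewrite /by_ => /negPf ->.
- move=> t ty; rewrite (@eq_bd_join _ _ b) ?db ?ty // => s ys; rewrite /by_.
  case: eqVneq => // sy; rewrite bU //.
  by apply/negP => /ymax; rewrite lt_neqAle eq_sym sy ys.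
have [||||||w wU dw] := IHn (U :\ y) _ _ _ _ (fun s : p.+1.-tuple A => b s - bd wy s).
- by rewrite (cardsD1 y) Uy in ltUn.
- by rewrite !inE (negPf U0) andbF.
- move=> u z; rewrite !inE => /andP[uy Uu] zu z0; rewrite (Udown u) // andbT.
  by apply: contra_neq uy => zy; apply/eqP; have := ymax _ Uu;
     rewrite -zy lt_neqAle zu andbT negbK eq_sym.
- by move=> u; rewrite inE => /andP[_ /Uacy].
- move=> s; rewrite !inE negb_and negbK.
  have [sy _|sy /= sU] := eqVneq; first by rewrite dwy // /by_ sy eqxx subrr.
  rewrite bU // sub0r (@eq_bd_join _ _ (fun=> 0)) ?bd0 ?oppr0 // => r sr.
  apply: wyy; apply: contraNneq sU => ry; apply: (Udown y) => //.
    by rewrite -ry.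
  exact: join_seq_neq0.
- by move=> t t0; rewrite bdB bd_bd db // subrr.
exists (fun s => w s + wy s) => [s sU | t].
  rewrite wU ?inE ?(negPf sU) ?andbF // wyy ?addr0 //.
  by apply: contraNneq sU => ->.
by rewrite bdD dw subrK.
Qed.

(** [bd z] lives strictly below [x], where the hypothesis fills it by some [w]. Then [z - w] is a
    cycle of the full simplex on the elements of [A] below [x], hence the boundary of a cone, and
    [w] has no part with join [x]. *)
Lemma relative_acyclicS p x :
  (forall y, (y < x)%O -> y != \bot%O -> relative_acyclic p y) ->
  relative_acyclic p.+1 x.
Proof.
move=> acy z zx dz.
have [a ax|noa] := pickP (fun a => (v a <= x)%O); last first.
  exists (fun=> 0) => // t tx; rewrite bd0 zx //.
  apply: contraFneq (noa (thead t)) => <-; exact/le_join_seq/mem_tnth.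
pose U := [set y | (y < x)%O && (y != \bot%O)].
have [|||||w wU dw] := @down_set_acyclic p U _ _ _ (bd z).
- by rewrite inE eqxx andbF.
- by move=> y u; rewrite !inE => /andP[yx _] /le_lt_trans -> //.
- by move=> y; rewrite inE => /andP[]; apply: acy.
- move=> s; rewrite inE join_seq_neq0 andbT => sx.
  have [/dz //|nsx] := eqVneq (join_seq s) x.
  rewrite (@eq_bd_join _ _ (fun=> 0)) ?bd0 // => r sr; apply: zx.
  by apply: contraNneq sx => rx; rewrite lt_neqAle nsx -rx.
- by move=> t _; rewrite bd_bd.
pose z' (s : p.+2.-tuple A) := z s - w s.
have dz' : bd z' =1 (fun=> 0) by move=> t; rewrite bdB dw subrr.
have z'x s : z' s != 0 -> (join_seq s <= x)%O.
  apply: contraNT => sx; rewrite /z' zx ?wU ?subrr //.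
    by rewrite inE negb_and lt_neqAle (negPf sx) andbF.
  by apply: contraNneq sx => ->.
exists (fun s : p.+3.-tuple A => if join_seq s == x then cone a z' s else 0)
  => [s /negPf -> //|t tx].
(* Discarding the part of the cone with join other than [x] is harmless at [t]: the whole cone is
   supported on joins at most [x], because [a] is below [x]. *)
rewrite (@eq_bd_join _ _ (cone a z')); last first.
  rewrite tx => s xs; case: eqVneq => // sx; apply/esym/eqP.
  apply: contra_neqT sx => nz; apply/eqP; rewrite eq_le xs andbT.
  move: nz; rewrite /cone; have [ta|_] := eqVneq (thead s) a; last by rewrite mul0r eqxx.
  rewrite mul1r => /z'x; case/tupleP: s ta xs => b s; rewrite theadE => -> _.
  by rewrite !join_seq_le /= ax.
rewrite bd_cone // /z' wU ?subr0 // tx inE ltxx //.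
Qed.

(** The coboundary [psi] of [phi] vanishes on pairs with join below [x], so it pairs to zero with
    every relative boundary; yet it is nonzero on the relative cycle [(a, b)]. *)
Lemma not_relative_acyclic1 (phi : A -> k) x a b :
  (forall c, v c != x) -> (v a `|` v b)%O = x -> phi a != phi b ->
  (forall c d, (v c `|` v d < x)%O -> phi c = phi d) ->
  ~ relative_acyclic 1 x.
Proof.
move=> xv abx phiab minx.
pose psi (t : 2.-tuple A) := \sum_(u : 1.-tuple A) incidence k t u * phi (thead u).
have psiE c d : psi [tuple c; d] = phi d - phi c.
  rewrite /psi big_tuple_cons exchange_big /= (big_pred1 [tuple]) => [|t];
    last exact/esym/eqP/tuple0.
  under eq_bigr => e _.
    rewrite /= subr0 mulr1 ?mulr1n ?mulr1 [[:: d] == _]/eq_op /= andbT theadE mulrBl.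
    over.
  rewrite sumrB; congr (_ - _).
    rewrite (bigD1 d) //= eqxx mul1r big1 ?addr0 // => e /negPf.
    by rewrite eq_sym => ->; rewrite mul0r.
  rewrite (bigD1 c) //= eqxx mul1r big1 ?addr0 // => e /negPf.
  by rewrite eq_sym => ->; rewrite mul0r.
have join2 c d : join_seq [:: c; d] = (v c `|` v d)%O.
  by rewrite /join_seq !big_cons big_nil joinx0.
pose z (s : 2.-tuple A) : k := (s == [tuple a; b])%:R.
move=> /(_ z) [s sx | t tx | w wx dw].
- by rewrite /z; case: eqVneq => // sab; move: sx; rewrite sab /= join2 abx eqxx.
- case/tupleP: t tx => c t; rewrite (tuple0 t) /join_seq /= big_cons big_nil joinx0.
  by move=> /eqP cx; have := xv c; rewrite cx.
have /eqP : \sum_(t : 2.-tuple A) bd w t * psi t = 0.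
  rewrite /bd; under eq_bigr => t _ do rewrite mulr_suml.
  rewrite exchange_big big1 //= => s _.
  under eq_bigr => t _ do rewrite -mulrA.
  rewrite -mulr_sumr /psi; under eq_bigr => t _ do rewrite mulr_sumr.
  rewrite exchange_big big1 ?mulr0 //= => u _.
  under eq_bigr => t _ do rewrite mulrA.
  by rewrite -mulr_suml incidence_sq mul0r.
rewrite (bigD1 [tuple a; b]) //= big1 => [|t tab].
  rewrite dw /= ?join2 // /z (eqxx [tuple a; b]) mul1r psiE addr0.
  by rewrite subr_eq0 eq_sym (negPf phiab).
have [tx|tx] := eqVneq (join_seq t) x; first by rewrite dw // /z (negPf tab) mul0r.
have [ltx|nltx] := boolP (join_seq t < x)%O.
  case/tupleP: t tab tx ltx => c t; case/tupleP: t => d t; rewrite (tuple0 t) /= => _ _.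
  rewrite join2 => /minx cd.
  have -> : [tuple of c :: [tuple of d :: [tuple]]] = [tuple c; d] by apply: val_inj.
  by rewrite psiE cd subrr mulr0.
rewrite (@eq_bd_join _ _ (fun=> 0)) ?bd0 ?mul0r // => s ts; apply: wx.
by apply: contraNneq nltx => sx; rewrite lt_neqAle tx -sx.
Qed.

(** The one-element tuple [a] is a relative cycle, its only face having join [\bot]. A filling could
    use only the pair [(a, a)], whose two faces cancel. *)
Lemma not_relative_acyclic0 a : (forall b c, (v b <= v c)%O -> b = c) ->
  ~ relative_acyclic 0 (v a).
Proof.
move=> anti; pose z (s : 1.-tuple A) : k := (s == [tuple a])%:R.
have join1 c : join_seq [:: c] = v c by rewrite /join_seq big_seq1.
move=> /(_ z) [s sx | t | w wx dw].
- by rewrite /z; case: eqVneq => // sa; move: sx; rewrite sa /= join1 eqxx.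
- rewrite (tuple0 t) /join_seq big_nil => /eqP.
  by rewrite eq_sym (negPf (v_neq0 a)).
have := dw [tuple a]; rewrite /= join1 => /(_ erefl) /eqP.
rewrite /z (eqxx [tuple a]) /bd big1 ?(eq_sym 0) ?oner_eq0 // => s _.
have [sa|/wx -> //] := eqVneq (join_seq s) (v a); last by rewrite mul0r.
case/tupleP: s sa => b s; case/tupleP: s => c s; rewrite (tuple0 s) /= => sa.
have ha d : d \in [:: b; c] -> d = a by move=> /le_join_seq; rewrite sa => /anti.
have -> : b = a by apply: ha; rewrite mem_head.
have -> : c = a by apply: ha; rewrite inE mem_head orbT.
by rewrite /= (eqxx a) (eqxx [:: a]) mul1r subr0 subrr mulr0.
Qed.

Lemma relative_acyclic0 x : (forall a, v a != x) -> relative_acyclic 0 x.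
Proof.
move=> vx z zx _; exists (fun=> 0) => // t tx; rewrite bd0 zx //.
case/tupleP: t tx => a t; rewrite (tuple0 t) /join_seq /= big_seq1 => ax.
by have := vx a; rewrite ax eqxx.
Qed.

End RelativeAcyclicity.

(** * Degrees and divisibility of monomials *)

Section Monomials.
Variables (k : fieldType) (n : nat).

Lemma mdeg_sub (m1 m2 : 'X_{1..n}) :
  (m1 <= m2)%MM -> mdeg (m2 - m1)%MM = (mdeg m2 - mdeg m1)%N.
Proof. by move=> /submK {2}<-; rewrite mdegD addnK. Qed.

Lemma mdeg_le (m1 m2 : 'X_{1..n}) : (m1 <= m2)%MM -> (mdeg m1 <= mdeg m2)%N.
Proof. by move=> /submK <-; rewrite mdegD leq_addl. Qed.

Lemma lem_anti (m1 m2 : 'X_{1..n}) :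
  (m1 <= m2)%MM -> (m2 <= m1)%MM -> m1 = m2.
Proof.
move=> /mnm_lepP m12 /mnm_lepP m21; apply/mnmP => i.
by apply/eqP; rewrite eqn_leq m12 m21.
Qed.

Lemma mcoeffMX_le (p : {mpoly k[n]}) (m m' : 'X_{1..n}) :
  (p * 'X_[m])@_m' = if (m <= m')%MM then p@_(m' - m) else 0.
Proof.
case: ifP => [/submK {1}<-|mm']; first by rewrite addmC mcoeffMX.
apply/eqP; rewrite mcoeff_eq0 (perm_mem (msuppMX _ _)).
by apply: contraFN mm' => /mapP[m1 _ ->]; apply: lem_addr.
Qed.

End Monomials.

(** * The Taylor complex on ordered tuples and its exactness *)

Section TaylorComplex.
Variables (k : fieldType) (n : nat) (A : finType) (g : A -> 'X_{1..n}).
Implicit Types (m u : 'X_{1..n}).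

Definition label (s : seq A) : 'X_{1..n} := \big[@mlcm n/0%MM]_(a <- s) g a.

Lemma label_le (s : seq A) m : (label s <= m)%MM = all (fun a => (g a <= m)%MM) s.
Proof.
rewrite /label; elim: s => [|a s IHs]; last by rewrite big_cons lem_mlcm IHs.
by rewrite big_nil; apply/mnm_lepP => i; rewrite mnm0E.
Qed.

Lemma label1 a : label [:: a] = g a.
Proof. by rewrite /label big_cons big_nil mlcm0. Qed.

Lemma label_subset (s t : seq A) : {subset t <= s} -> (label t <= label s)%MM.
Proof.
move=> ts; rewrite label_le; apply/allP => a /ts sa.
by move: (lepm_refl (label s)); rewrite label_le => /allP; apply.
Qed.

Lemma incidence_label (s t : seq A) : incidence k s t != 0 -> (label t <= label s)%MM.
Proof. by move=> /incidence_subset; apply: label_subset. Qed.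

Definition taylor_dif p :
    'M[{mpoly k[n]}]_(#|{: p.+1.-tuple A}|, #|{: p.-tuple A}|) :=
  \matrix_(i < #|{: p.+1.-tuple A}|, j < #|{: p.-tuple A}|)
    let s := enum_val i in let t := enum_val j in
    incidence k s t *: 'X_[label s - label t].

(* A basis element is an ordered tuple of generators, repetitions allowed:
   larger than the usual Taylor complex, but free of orientation signs, and
   prepending a generator is a contraction. *)
Definition taylor : graded_free_seq k n :=
  @GradedFreeSeq k n (fun i => #|{: i.+1.-tuple A}|)
    (fun i a => mdeg (label (enum_val a)))
    (col (enum_rank [tuple]) (taylor_dif 0))
    (fun i => taylor_dif i.+1).

(* The component of [v] in the multidegree [u]. *)
Definition multideg_part p (v : 'rV[{mpoly k[n]}]_#|{: p.-tuple A}|) u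
    (t : p.-tuple A) : k :=
  if (label t <= u)%MM then (v ord0 (enum_rank t))@_(u - label t) else 0.

Lemma multideg_part_inj p (v w : 'rV[{mpoly k[n]}]_#|{: p.-tuple A}|) :
  (forall u, multideg_part v u =1 multideg_part w u) -> v = w.
Proof.
move=> vw; apply/rowP => i; apply/mpolyP => m.
have := vw (m + label (enum_val i))%MM (enum_val i).
by rewrite /multideg_part lem_addl addmK enum_valK.
Qed.

(** The monomials in [taylor_dif] are those that preserve multidegrees, so in a fixed multidegree
    only the scalars [incidence] remain. *)
Lemma multideg_part_dif p (v : 'rV_#|{: p.+1.-tuple A}|) u :
  multideg_part (v *m taylor_dif p) u =1 bd (multideg_part v u).
Proof.
move=> t; rewrite /multideg_part /bd mxE (reindex enum_rank) /=; last first.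
  by apply: onW_bij; apply: enum_rank_bij.
rewrite raddf_sum /=.
have -> (b : bool) (F : p.+1.-tuple A -> k) :
    (if b then \sum_s F s else 0) = \sum_s (if b then F s else 0).
  by case: b; rewrite // big1.
apply: eq_bigr => s _; rewrite mxE !enum_rankK -scalerAr mcoeffZ mcoeffMX_le.
have [->|/incidence_label ts] := eqVneq (incidence k s t) 0.
  by rewrite !mul0r mulr0 if_same.
rewrite mulrC; have [su|nsu] := boolP (label s <= u)%MM; last first.
  rewrite mul0r; case: ifP => // tu; case: ifP => [stu|_]; last by rewrite mul0r.
  case/negP: nsu; apply/mnm_lepP => i; move/mnm_lepP/(_ i): stu.
  move/mnm_lepP/(_ i): tu; move/mnm_lepP/(_ i): ts; rewrite !mnmBE => a b.
  by rewrite leq_subLR subnKC.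
rewrite (lepm_trans ts su).
have -> : (label s - label t <= u - label t)%MM.
  apply/mnm_lepP => i; rewrite !mnmBE leq_sub2r //; exact/mnm_lepP.
congr (_@__ * _); apply/mnmP => i; rewrite !mnmBE subnBA ?subnK //.
  by apply/mnm_lepP/(lepm_trans ts su).
exact/mnm_lepP.
Qed.

(** The apex of the cone in multidegree [u]; what matters is that the choice depends on [u]
    alone. *)
Definition least_gen u : option A := [pick a | (g a <= u)%MM].

(** The cones, whose apex varies with [u], come from a single row of polynomials, because each entry
    of [v] has only finitely many monomials. *)
Lemma taylor_lift p (v : 'rV_#|{: p.+1.-tuple A}|) :
  exists w : 'rV_#|{: p.+2.-tuple A}|, forall u s,
    multideg_part w u s =
      (least_gen u == Some (thead s))%:R * multideg_part v u (behead_tuple s).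
Proof.
(* A monomial [m] of the coefficient at the tail of [s] lies in multidegree [m + l]; it is copied to
   [s] when the head of [s] is the apex there, with exponent [m + l - label s] to keep the
   multidegree. *)
pose wE (s : p.+2.-tuple A) : {mpoly k[n]} :=
  let l := label (behead s) in
  let q := v ord0 (enum_rank (behead_tuple s)) in
  \sum_(m <- msupp q | (label s <= m + l)%MM &&
        (least_gen (m + l)%MM == Some (thead s)))
     q@_m *: 'X_[m + l - label s].
exists (\row_i wE (enum_val i)) => u s.
rewrite /multideg_part mxE enum_rankK {}/wE /=.
set l := label (behead s); set q := v ord0 _.
have ls : (l <= label s)%MM by apply: label_subset => a; apply: mem_behead.
have [su|nsu] := boolP (label s <= u)%MM; last first.
  have [/eqP|] := boolP (_ == _); last by rewrite mul0r.
  rewrite /least_gen; case: pickP => // a gau [ta]; rewrite mul1r.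
  case: ifP => // lu; case/negP: nsu; move: lu; rewrite /l !label_le => bu.
  by rewrite (tuple_eta s) /= -ta gau.
have lu := lepm_trans ls su; rewrite lu raddf_sum /=.
transitivity (\sum_(m <- msupp q | m == (u - l)%MM)
   (least_gen u == Some (thead s))%:R * q@_(u - l)).
  rewrite [LHS]big_mkcond [RHS]big_mkcond /=; apply: eq_bigr => m _.
  rewrite mcoeffZ mcoeffX; case: (eqVneq m (u - l)%MM) => [->|mu].
    rewrite submK // su eqxx /=.
    by case: eqP; rewrite ?mul1r ?mul0r ?mulr1.
  case: ifP => // /andP[sm _].
  case: eqP => [/(congr1 (fun x => x + label s)%MM)|_]; last by rewrite mulr0.
  by rewrite !submK // => mlu; move: mu; rewrite -mlu addmK eqxx.
rewrite -big_filter.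
have [qu|qu] := boolP ((u - l)%MM \in msupp q).
  by rewrite filter_pred1_uniq ?msupp_uniq // big_seq1.
by rewrite big1_seq ?(memN_msupp_eq0 qu) ?mulr0.
Qed.

(** In each multidegree a cycle is the boundary of its cone, or is zero when no generator divides
    that multidegree. *)
Lemma taylor_exact p (v : 'rV_#|{: p.+1.-tuple A}|) :
  v *m taylor_dif p = 0 <-> exists w, v = w *m taylor_dif p.+1.
Proof.
have part0 q u : multideg_part (0 : 'rV_#|{: q.-tuple A}|) u =1 fun=> 0.
  by move=> s; rewrite /multideg_part mxE mcoeff0 if_same.
split=> [dv|[w ->]]; last first.
  apply: multideg_part_inj => u s; rewrite multideg_part_dif part0.
  rewrite -[RHS](bd_bd (multideg_part w u) s).
  by apply: eq_bigr => t _; rewrite multideg_part_dif.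
have [w wE] := taylor_lift v; exists w; apply: multideg_part_inj => u s.
rewrite multideg_part_dif.
have dvu : bd (multideg_part v u) =1 fun=> 0.
  by move=> t; rewrite -multideg_part_dif dv part0.
case Eu: (least_gen u) => [a|].
  rewrite -[LHS](bd_cone a dvu); apply: eq_bigr => t _.
  by rewrite wE Eu /cone /= eq_sym.
rewrite /bd big1 => [|t _]; last by rewrite wE Eu mul0r mul0r.
rewrite /multideg_part; case: ifP => //; rewrite label_le (tuple_eta s) /= => /andP[].
by move: Eu; rewrite /least_gen; case: pickP => // ->.
Qed.

Lemma taylor_graded : graded_maps taylor.
Proof.
have hom p (s : p.+1.-tuple A) (t : p.-tuple A) :
    if (mdeg (label t) <= mdeg (label s))%N then
      incidence k s t *: 'X_[label s - label t]
        \is (mdeg (label s) - mdeg (label t)).-homog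
    else incidence k s t *: 'X_[k, label s - label t] == 0.
  have [->|/incidence_label ts] := eqVneq (incidence k s t) 0.
    by rewrite scale0r eqxx dhomog0 if_same.
  by rewrite mdeg_le // dhomogZ // dhomogX /= mdeg_sub.
split=> [a|i a b] /=; last by rewrite !mxE; apply: hom.
have := hom _ (enum_val a) [tuple].
by rewrite !mxE enum_rankK /label big_nil mdeg0 subn0.
Qed.

Lemma taylor_augE (v : 'rV_(rk taylor 0)) :
  v *m aug taylor =
    (\sum_a v ord0 (enum_rank [tuple a]) * 'X_[g a])%:M.
Proof.
apply/matrixP => i j; rewrite !ord1 !mxE eqxx mulr1n.
rewrite (reindex enum_rank) /=; last by apply: onW_bij; apply: enum_rank_bij.
rewrite big_tuple_cons; apply: eq_bigr => a _.
rewrite (big_pred1 [tuple]) => [|t]; last exact/esym/eqP/tuple0.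
rewrite !mxE !enum_rankK /= subr0 scale1r label1 /label big_nil.
congr (v _ (enum_rank _) * 'X_[_]).
by apply/mnmP => x; rewrite mnmBE mnm0E subn0.
Qed.

Lemma taylor_resolution (I : {mpoly k[n]} -> Prop) :
  (forall p, I p <-> ideal_span (fun q => exists a, q = 'X_[g a]) p) ->
  is_graded_free_resolution I taylor.
Proof.
move=> Ispan; split.
- exact: taylor_graded.
- move=> p; rewrite Ispan; split=> [[s [sg ->]]|[v]]; last first.
    rewrite taylor_augE => /matrixP/(_ ord0 ord0); rewrite !mxE eqxx !mulr1n => ->.
    exists [seq (v ord0 (enum_rank [tuple a]), 'X_[g a]) | a <- enum A].
    by split=> [c /mapP[a _ ->]|]; [exists a | rewrite big_map big_enum].
  elim: s sg => [|c s IHs] sg.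
    by exists 0; rewrite mul0mx big_nil; apply/matrixP => i j; rewrite !mxE mul0rn.
  have [|v vE] := IHs; first by move=> d sd; apply: sg; rewrite inE sd orbT.
  have [a ca] := sg c (mem_head _ _).
  exists (v + \row_i (if i == enum_rank [tuple a] then c.1 else 0)).
  rewrite big_cons mulmxDl -vE addrC raddfD; congr (_ + _).
  rewrite taylor_augE (bigD1 a) //= mxE eqxx -ca big1 ?addr0 // => b ba.
  rewrite mxE; case: eqP => [/enum_rank_inj/(congr1 val)[] ab|]; last by rewrite mul0r.
  by rewrite ab eqxx in ba.
(* The empty tuple is the only column of [taylor_dif 0], so this is [taylor_exact] with [p = 0]. *)
- move=> v; rewrite -taylor_exact; split=> [va|dv].
    apply/rowP => j; move/matrixP/(_ ord0 ord0): va; rewrite !mxE => va.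
    rewrite -[RHS]va; apply: eq_bigr => s _; rewrite !mxE.
    by rewrite [enum_val j]tuple0 [enum_val (enum_rank _)]tuple0.
  apply/matrixP => i j; rewrite !ord1.
  move/rowP/(_ (enum_rank [tuple])): dv; rewrite !mxE => dv.
  by rewrite -[RHS]dv; apply: eq_bigr => s _; rewrite !mxE.
- by move=> i v; apply: taylor_exact.
Qed.

End TaylorComplex.

(** * Degree-preserving matrices and their reduction modulo the variables *)

Section GradedMatrices.
Variables (k : fieldType) (n : nat).
Implicit Types p q : {mpoly k[n]}.

Definition homog_shift (a b : nat) p : bool :=
  if (b <= a)%N then p \is (a - b).-homog else p == 0.

Definition graded_mx m1 m2 (ga : 'I_m1 -> nat) (gb : 'I_m2 -> nat)
    (M : 'M[{mpoly k[n]}]_(m1, m2)) : Prop :=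
  forall i j, homog_shift (ga i) (gb j) (M i j).

Definition shift_part (a b : nat) p : {mpoly k[n]} :=
  if (b <= a)%N then pihomog mdeg (a - b) p else 0.

Lemma shift_part_homog a b p : homog_shift a b (shift_part a b p).
Proof.
by rewrite /homog_shift /shift_part; case: (b <= a)%N => //; apply: pihomogP.
Qed.

Lemma shift_part_id a b p : homog_shift a b p -> shift_part a b p = p.
Proof.
rewrite /homog_shift /shift_part; case: (b <= a)%N; last by move/eqP.
exact: pihomog_dE.
Qed.

Lemma shift_part_sum a b (J : finType) (F : J -> {mpoly k[n]}) :
  shift_part a b (\sum_i F i) = \sum_i shift_part a b (F i).
Proof.
rewrite /shift_part; case: (b <= a)%N; last by rewrite big1.
exact: raddf_sum.
Qed.

Lemma pihomogM d e p q : q \is e.-homog ->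
  pihomog mdeg d (p * q) = if (e <= d)%N then pihomog mdeg (d - e) p * q else 0.
Proof.
move=> qe; have [K leK] : {K | (mmeasure mdeg p <= K)%N & (d < K)%N}.
  exists (maxn (mmeasure mdeg p) d.+1); [exact: leq_maxl | exact: leq_maxr].
move=> dK; rewrite {1}(pihomog_partitionE leK) mulr_suml raddf_sum /=.
have homi (i : 'I_K) : pihomog mdeg i p * q \is (i + e).-homog.
  by rewrite dhomogM ?pihomogP.
case: leqP => [ed|de]; last first.
  rewrite big1 // => i _; apply: pihomog_ne0 (homi i).
  by rewrite gtn_eqF // (leq_trans de) // leq_addl.
have dK' : (d - e < K)%N by apply: leq_ltn_trans dK; apply: leq_subr.
rewrite (bigD1 (Ordinal dK')) //= big1 ?addr0 => [|i ne].
  by rewrite pihomog_dE // -[X in _ \is X.-homog](subnK ed) (homi (Ordinal dK')).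
apply: pihomog_ne0 (homi i); apply: contra_neq ne => /= ide.
by apply: val_inj; rewrite /= -ide addnK.
Qed.

Lemma shift_partM a b c p q :
  homog_shift b c q -> shift_part a c (p * q) = shift_part a b p * q.
Proof.
rewrite /homog_shift /shift_part; case: leqP => cb; last first.
  by move/eqP->; rewrite !mulr0 linear0 if_same.
move=> qh; rewrite (pihomogM _ _ qh); have [ca|ac] := leqP c a; last first.
  by rewrite leqNgt (leq_trans ac cb) mul0r.
rewrite leq_sub2rE // subnBA // subnK //.
by case: (b <= a)%N; rewrite ?mul0r.
Qed.

(** A graded [N] sends the parts of [M] of wrong degree to parts of wrong degree, which a graded
    product lacks. So any factorization through [N] can be made graded. *)
Lemma shift_part_mulmx m1 m2 m3 (ga : 'I_m1 -> nat) (gb : 'I_m2 -> nat)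
    (gc : 'I_m3 -> nat) M N :
  graded_mx gb gc N -> graded_mx ga gc (M *m N) ->
  M *m N = (\matrix_(i, j) shift_part (ga i) (gb j) (M i j)) *m N.
Proof.
move=> gN gMN; apply/matrixP => i j.
rewrite -(shift_part_id (gMN i j)) !mxE shift_part_sum.
by apply: eq_bigr => l _; rewrite !mxE (shift_partM _ _ (gN l j)).
Qed.

Lemma row_lift m1 m2 m3 (M : 'M[{mpoly k[n]}]_(m1, m3))
    (N : 'M[{mpoly k[n]}]_(m2, m3)) :
  (forall i, exists w, row i M = w *m N) -> exists W, M = W *m N.
Proof.
move=> /fin_all_exists[w wE]; exists (\matrix_(i, j) w i ord0 j).
apply/row_matrixP => i; rewrite wE row_mul; congr (_ *m _).
by apply/rowP => j; rewrite !mxE.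
Qed.

Lemma graded_row_lift m1 m2 m3 (ga : 'I_m1 -> nat) (gb : 'I_m2 -> nat)
    (gc : 'I_m3 -> nat) M N :
  graded_mx ga gc M -> graded_mx gb gc N ->
  (forall i, exists w, row i M = w *m N) ->
  exists2 W, graded_mx ga gb W & M = W *m N.
Proof.
move=> gM gN /row_lift[W MW]; rewrite MW in gM.
exists (\matrix_(i, j) shift_part (ga i) (gb j) (W i j)).
  by move=> i j; rewrite mxE shift_part_homog.
by rewrite -(shift_part_mulmx gN gM).
Qed.

Lemma graded_mx_mul m1 m2 m3 (ga : 'I_m1 -> nat) (gb : 'I_m2 -> nat)
    (gc : 'I_m3 -> nat) M N :
  graded_mx ga gb M -> graded_mx gb gc N -> graded_mx ga gc (M *m N).
Proof.
move=> gM gN i j; suff <- : shift_part (ga i) (gc j) ((M *m N) i j) = (M *m N) i j.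
  exact: shift_part_homog.
rewrite mxE shift_part_sum; apply: eq_bigr => l _.
by rewrite (shift_partM _ _ (gN l j)) shift_part_id.
Qed.

Definition residue m1 m2 (M : 'M[{mpoly k[n]}]_(m1, m2)) : 'M[k]_(m1, m2) :=
  map_mx (mcoeff 0%MM) M.

Lemma residueM m1 m2 m3 (M : 'M_(m1, m2)) (N : 'M_(m2, m3)) :
  residue (M *m N) = residue M *m residue N.
Proof. exact: map_mxM. Qed.

Lemma homog_shift_coeff0 a b p : homog_shift a b p -> p@_0%MM != 0 -> a = b.
Proof.
rewrite /homog_shift; case: leqP => [ba|_]; last by move/eqP->; rewrite mcoeff0 eqxx.
move=> ph; apply: contra_neq_eq => ab; apply: dhomog_nemf_coeff ph _.
by rewrite /= mdeg0 eq_sym subn_eq0 -ltnNge ltn_neqAle ba andbT eq_sym.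
Qed.

End GradedMatrices.

(** * Comparison of graded resolutions and transfer of Tor vanishing *)

Section Comparison.
Variables (k : fieldType) (n : nat).
Implicit Types (F T : graded_free_seq k n) (I : {mpoly k[n]} -> Prop).

Lemma degree_partK F i j : degree_part F i j *m degree_part F i j = degree_part F i j.
Proof.
rewrite /degree_part mulmx_diag; congr diag_mx; apply/rowP => a.
by rewrite !mxE -natrM mulnb andbb.
Qed.

Lemma sub_degree_part F i j m (z : 'M_(m, rk F i)) :
  (z <= degree_part F i j)%MS -> z *m degree_part F i j = z.
Proof. by move=> /submxP[w ->]; rewrite -mulmxA degree_partK. Qed.

Lemma degree_part_graded F T i i' j (M : 'M[{mpoly k[n]}]_(rk F i, rk T i')) :
  graded_mx (@gdeg _ _ F i) (@gdeg _ _ T i') M ->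
  degree_part F i j *m residue M = residue M *m degree_part T i' j.
Proof.
move=> gM; rewrite mul_diag_mx mul_mx_diag; apply/matrixP => a b; rewrite !mxE.
have [->|/(homog_shift_coeff0 (gM a b)) ->] := eqVneq ((M a b)@_0%MM) 0.
  by rewrite mulr0 mul0r.
exact: mulrC.
Qed.

Section Resolution.
Variables (I : {mpoly k[n]} -> Prop) (F : graded_free_seq k n).
Hypothesis resF : is_graded_free_resolution I F.

Lemma graded_dif i : graded_mx (@gdeg _ _ F i.+1) (@gdeg _ _ F i) (dif F i).
Proof. by case: resF => -[_ gF] _ _ _ a b; apply: gF. Qed.

Lemma graded_aug : graded_mx (@gdeg _ _ F 0) (fun=> 0%N) (aug F).
Proof.
case: resF => -[gF _] _ _ _ a b.
by rewrite /homog_shift subn0 (ord1 b); apply: gF.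
Qed.

Lemma aug_row_lift m (M : 'M_(m, rk F 0)) : M *m aug F = 0 ->
  forall i, exists w, row i M = w *m dif F 0.
Proof.
by move=> M0 i; case: resF => _ _ ex _; apply/ex; rewrite -row_mul M0 row0.
Qed.

Lemma dif_row_lift i m (M : 'M_(m, rk F i.+1)) : M *m dif F i = 0 ->
  forall i', exists w, row i' M = w *m dif F i.+1.
Proof.
by move=> M0 i'; case: resF => _ _ _ ex; apply/ex; rewrite -row_mul M0 row0.
Qed.

Lemma dif_aug : dif F 0 *m aug F = 0.
Proof.
apply/row_matrixP => i; rewrite row_mul row0; case: resF => _ _ ex _; apply/ex.
by exists (delta_mx 0 i); rewrite rowE.
Qed.

Lemma dif_dif i : dif F i.+1 *m dif F i = 0.
Proof.
apply/row_matrixP => a; rewrite row_mul row0; case: resF => _ _ _ ex; apply/ex.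
by exists (delta_mx 0 a); rewrite rowE.
Qed.

Lemma boundariesE i j : boundaries F i j = dif_k F i *m degree_part F i j.
Proof. exact: degree_part_graded (graded_dif (i:=i)). Qed.

Lemma boundaries_sub_cycles i j : (boundaries F i j <= cycles F i j)%MS.
Proof.
case: i => [|i]; first by rewrite boundariesE submxMl.
rewrite sub_capmx boundariesE submxMl /= -boundariesE; apply/sub_kermxP.
by rewrite -mulmxA -residueM dif_dif /residue map_mx0 mulmx0.
Qed.

Lemma tor_dim_eq0 i j :
  tor_dim F i j = 0%N -> (cycles F i j <= boundaries F i j)%MS.
Proof.
move/eqP; rewrite subn_eq0 => rk_le.
by rewrite -(geq_leqif (mxrank_leqif_sup (boundaries_sub_cycles i j))).
Qed.

End Resolution.

Lemma aug_lift I F T :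
  is_graded_free_resolution I F -> is_graded_free_resolution I T ->
  exists2 W, graded_mx (@gdeg _ _ T 0) (@gdeg _ _ F 0) W & aug T = W *m aug F.
Proof.
move=> rF rT; apply: graded_row_lift (graded_aug rT) (graded_aug rF) _ => i.
have -> : row i (aug T) = (aug T i ord0)%:M.
  by apply/matrixP => a b; rewrite !ord1 !mxE eqxx.
have [_ IF _ _] := rF; apply/IF; have [_ IT _ _] := rT; apply/IT.
exists (delta_mx 0 i); rewrite -rowE.
by apply/matrixP => a b; rewrite !ord1 !mxE eqxx.
Qed.

Section TwoResolutions.
Variables (I : {mpoly k[n]} -> Prop) (F T : graded_free_seq k n).
Hypotheses (rF : is_graded_free_resolution I F).
Hypotheses (rT : is_graded_free_resolution I T).

Lemma lift_dif i (psi : 'M_(rk F i, rk T i)) psi' :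
  dif F i *m psi = psi' *m dif T i ->
  exists psi'', dif F i.+1 *m psi' = psi'' *m dif T i.+1.
Proof.
move=> psiE; apply: row_lift; apply: (dif_row_lift rT).
by rewrite -mulmxA -psiE mulmxA (dif_dif rF) mul0mx.
Qed.

Lemma lift_homotopy i phi psi h phi' psi' :
  dif T i *m phi = phi' *m dif F i -> dif F i *m psi = psi' *m dif T i ->
  dif T i *m (phi *m psi - 1%:M - h *m dif T i) = 0 ->
  exists h', phi' *m psi' - 1%:M - dif T i *m h = h' *m dif T i.+1.
Proof.
move=> phiE psiE hE; apply: row_lift; apply: (dif_row_lift rT).
rewrite -[RHS]hE !mulmxBl !mulmxBr mul1mx mulmx1.
by rewrite -!mulmxA -psiE [phi' *m _]mulmxA -phiE !mulmxA.
Qed.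

Lemma comparison0 : exists phi psi psi' h,
  [/\ graded_mx (@gdeg _ _ T 0) (@gdeg _ _ F 0) phi, aug T = phi *m aug F,
      dif F 0 *m psi = psi' *m dif T 0 & phi *m psi - 1%:M = h *m dif T 0].
Proof.
have [phi gphi phiE] := aug_lift rF rT.
have [psi _ psiE] := aug_lift rT rF.
have [|psi' psi'E] := row_lift (aug_row_lift rT (M := dif F 0 *m psi) _).
  by rewrite -mulmxA -psiE (dif_aug rF).
have [|h hE] := row_lift (aug_row_lift rT (M := phi *m psi - 1%:M) _).
  by rewrite mulmxBl mul1mx -mulmxA -psiE -phiE subrr.
by exists phi, psi, psi', h.
Qed.

(* [phi], [psi] are level [i] of chain maps lifting the identity of [I], [phi'],
   [psi'] their next level; [h] is level [i] of a homotopy from [1] to [phi psi],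
   the term with level [i - 1] being killed by [dif T i]. *)
Lemma comparison i : exists phi psi h phi' psi',
  [/\ graded_mx (@gdeg _ _ T i) (@gdeg _ _ F i) phi,
      graded_mx (@gdeg _ _ T i.+1) (@gdeg _ _ F i.+1) phi',
      dif T i *m phi = phi' *m dif F i,
      dif F i *m psi = psi' *m dif T i &
      dif T i *m (phi *m psi - 1%:M - h *m dif T i) = 0].
Proof.
elim: i => [|i [phi [psi [h [phi' [psi' [_ gphi' phiE psiE hE]]]]]]].
  have [phi [psi [psi' [h [gphi phiE psiE hE]]]]] := comparison0.
  have [||phi' gphi' phi'E] := graded_row_lift (ga := @gdeg _ _ T 1)
      (M := dif T 0 *m phi) _ (graded_dif (i:=0) rF) (aug_row_lift rF _).
  - exact: graded_mx_mul (graded_dif (i:=0) rT) gphi.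
  - by rewrite -mulmxA -phiE (dif_aug rT).
  by exists phi, psi, h, phi', psi'; split=> //; rewrite hE subrr mulmx0.
have [||phi'' gphi'' phi''E] := graded_row_lift (ga := @gdeg _ _ T i.+2)
    (M := dif T i.+1 *m phi') _ (graded_dif (i:=i.+1) rF) (dif_row_lift rF _).
- exact: graded_mx_mul (graded_dif (i:=i.+1) rT) gphi'.
- by rewrite -mulmxA -phiE mulmxA (dif_dif rT) mul0mx.
have [psi'' psi''E] := lift_dif psiE.
have [h' h'E] := lift_homotopy phiE psiE hE.
exists phi', psi', h', phi'', psi''; split=> //.
by rewrite -h'E opprB addrC subrK mulmxA (dif_dif rT) mul0mx.
Qed.

(** Write [z] as [z phi psi - z (phi psi - 1)]: chain maps send boundaries to boundaries, and the
    homotopy handles the second term. [psi] carries no grading; projecting to degree [j] by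
    [boundariesE] restores the degree. *)
Lemma boundary_of_comparison i j phi psi psi' (z : 'rV_(rk T i)) :
  graded_mx (@gdeg _ _ T i) (@gdeg _ _ F i) phi ->
  dif F i *m psi = psi' *m dif T i ->
  z *m degree_part T i j = z ->
  (z *m residue phi <= boundaries F i j)%MS ->
  (z *m residue (phi *m psi - 1%:M) <= dif_k T i)%MS ->
  (z <= boundaries T i j)%MS.
Proof.
move=> gphi psiE zj zphi zh.
rewrite -zj (boundariesE rT); apply: submxMr.
have -> : z = z *m residue (phi *m psi) - z *m residue (phi *m psi - 1%:M).
  by rewrite /residue map_mxB map_mx1 mulmxBr mulmx1 subKr.
rewrite addmx_sub ?eqmx_opp // residueM mulmxA.
apply: submx_trans (submxMr _ zphi) _; rewrite -mulmxA.
by rewrite -[dif_k F i]/(residue _) -residueM psiE residueM mulmxA submxMl.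
Qed.

(** Up to homotopy the identity of [T] factors through [F], so a cycle of [T] tensored with [k]
    bounds as soon as its image in [F] does. *)
Lemma tor_transfer i j :
  tor_dim F i j = 0%N -> (cycles T i j <= boundaries T i j)%MS.
Proof.
move=> /(tor_dim_eq0 rF) cF; apply/row_subP => r; move: (row_sub r (cycles T i j)).
move: (row r _) => z {r}; case: i cF z => [|i] cF z zc.
  have zj := sub_degree_part zc.
  have [phi [psi [psi' [h [gphi _ psiE hE]]]]] := comparison0.
  apply: (boundary_of_comparison gphi psiE zj).
    apply: submx_trans cF; rewrite -zj -mulmxA (degree_part_graded _ gphi).
    by rewrite mulmxA submxMl.
  by rewrite hE residueM mulmxA submxMl.
have [phi [psi [h [phi' [psi' [_ gphi' phiE psiE hE]]]]]] := comparison i.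
move: zc; rewrite sub_capmx => /andP[/sub_degree_part zj /sub_kermxP zd].
have [psi'' psi''E] := lift_dif psiE.
have [h' h'E] := lift_homotopy phiE psiE hE.
apply: (boundary_of_comparison gphi' psi''E zj).
  apply: submx_trans cF; rewrite sub_capmx; apply/andP; split.
    by rewrite -zj -mulmxA (degree_part_graded _ gphi') mulmxA submxMl.
  apply/sub_kermxP; rewrite -[dif_k F i]/(residue _) -mulmxA -residueM -phiE.
  by rewrite residueM mulmxA zd mul0mx.
(* The homotopy has two terms: the one from [h'] gives a boundary, the one through [dif T i]
   vanishes because [z] is a cycle. *)
rewrite -(subrK (dif T i *m h) (_ - _)) h'E /residue map_mxD mulmxDr.
by rewrite -!/(residue _) !residueM !mulmxA zd mul0mx addr0 submxMl.
Qed.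

End TwoResolutions.
End Comparison.

(** * Tor of a Taylor complex as a sum over the lattice *)

Section TaylorTor.
Variables (k : fieldType) (n : nat) (A : finType).
Context {disp : Order.disp_t} (L : finTBLatticeType disp) (v : A -> L).
Variables (g : A -> 'X_{1..n}) (mon : L -> 'X_{1..n}).
Hypothesis v_neq0 : forall a, v a != \bot%O.
Hypothesis label_mon : forall s : seq A, label g s = mon (join_seq v s).
Hypothesis mon_inj : forall x y : L,
  x != \bot%O -> y != \bot%O -> mon x = mon y -> x = y.

Let T := taylor k g.

(** Modulo the variables an entry survives only when the two labels, hence the two joins, agree;
    this is the splitting into the complexes C(y). *)
Lemma taylor_dif_kE i (w : 'rV_(rk T i.+1)) t :
  (w *m dif_k T i) ord0 (enum_rank t) =
    \sum_s w ord0 (enum_rank s) *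
      (incidence k s t * (join_seq v s == join_seq v t)%:R).
Proof.
rewrite mxE (reindex enum_rank) /=; last by apply: onW_bij; apply: enum_rank_bij.
apply: eq_bigr => s _; congr (_ * _); rewrite !mxE !enum_rankK mcoeffZ mcoeffX.
have [->|inc] := eqVneq (incidence k s t) 0; first by rewrite !mul0r.
congr (_ * _%:R); congr (nat_of_bool _); apply/eqP/eqP => [st0|st].
  have := submK (incidence_label g inc); rewrite st0 add0m !label_mon => /esym.
  by apply: mon_inj; apply: join_seq_neq0.
by apply/mnmP => x; rewrite mnmBE !label_mon st subnn mnm0E.
Qed.

Lemma taylor_degree_partE i j (z : 'rV_(rk T i)) t :
  (z *m degree_part T i j) ord0 (enum_rank t) =
    z ord0 (enum_rank t) * (mdeg (mon (join_seq v t)) == j)%:R.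
Proof. by rewrite mul_mx_diag !mxE /= enum_rankK label_mon. Qed.

Lemma row_enumP p (z w : 'rV[k]_#|{: p.-tuple A}|) :
  (forall t, z ord0 (enum_rank t) = w ord0 (enum_rank t)) -> z = w.
Proof. by move=> zw; apply/rowP => a; rewrite -(enum_valK a). Qed.

Lemma relative_acyclic_of_tor i x :
  x != \bot%O ->
  (cycles T i (mdeg (mon x)) <= boundaries T i (mdeg (mon x)))%MS ->
  relative_acyclic k v i x.
Proof.
move=> x0 cb z zx dz; set j := mdeg (mon x) in cb.
pose zr : 'rV_(rk T i) := \row_a z (enum_val a).
have zrE t : zr ord0 (enum_rank t) = z t by rewrite mxE enum_rankK.
have zrj : zr = zr *m degree_part T i j.
  apply: row_enumP => t; rewrite taylor_degree_partE zrE.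
  have [tx|/zx ->] := eqVneq (join_seq v t) x; last by rewrite mul0r.
  by rewrite tx eqxx mulr1.
have /submx_trans/(_ cb)/submxP[w] : (zr <= cycles T i j)%MS.
  case: i z zx dz @zr zrE zrj {cb} => [|i] z zx dz zr zrE zrj.
    by rewrite zrj submxMl.
  rewrite sub_capmx {1}zrj submxMl; apply/sub_kermxP; apply: row_enumP => t.
  rewrite taylor_dif_kE mxE.
  have [tx|tx] := eqVneq (join_seq v t) x; last first.
    rewrite big1 // => s _; rewrite zrE.
    have [sx|/zx ->] := eqVneq (join_seq v s) x; last by rewrite mul0r.
    by rewrite sx eq_sym (negPf tx) !mulr0.
  rewrite -[RHS](dz t tx) /bd; apply: eq_bigr => s _; rewrite zrE tx.
  have [sx|/zx ->] := eqVneq (join_seq v s) x; last by rewrite !mul0r.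
  by rewrite mulr1.
rewrite /boundaries mulmxA; move: (w *m _) => {}w zw.
exists (fun s : i.+2.-tuple A => if join_seq v s == x then w ord0 (enum_rank s) else 0).
  by move=> s /negPf ->.
move=> t tx; rewrite -(zrE t) zw taylor_dif_kE; apply: eq_bigr => s _.
by rewrite tx; case: eqP; rewrite ?mulr1 // !mulr0 mul0r.
Qed.

(** A cycle is the sum of its parts with given join [x], each a relative cycle; the parts with
    [mdeg (mon x)] other than [j] vanish. *)
Lemma tor_of_relative_acyclic i j :
  (forall x, x != \bot%O -> mdeg (mon x) = j -> relative_acyclic k v i x) ->
  (cycles T i j <= boundaries T i j)%MS.
Proof.
move=> acy; apply/row_subP => r; move: (row_sub r (cycles T i j)).
move: (row r _) => z zc {r}.
have zj : z *m degree_part T i j = z.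
  by apply: sub_degree_part; case: i z zc {acy} => // i z;
     rewrite sub_capmx => /andP[].
have zd (t : i.-tuple A) : (0 < i)%N ->
    \sum_(s : i.+1.-tuple A) z ord0 (enum_rank s) *
      (incidence k s t * (join_seq v s == join_seq v t)%:R) = 0.
  case: i z zc t {acy zj} => // i z; rewrite sub_capmx => /andP[_ /sub_kermxP zk] t _.
  by rewrite -taylor_dif_kE zk mxE.
have -> : z = \sum_x \row_(a < #|{: i.+1.-tuple A}|)
    (if join_seq v (enum_val a) == x then z ord0 a else 0).
  apply/rowP => a; rewrite summxE (bigD1 (join_seq v (enum_val a))) //= mxE eqxx.
  by rewrite big1 ?addr0 // => x; rewrite mxE eq_sym => /negPf ->.
apply: summx_sub => x _.
have [->|x0] := eqVneq x \bot%O.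
  rewrite [X in (X <= _)%MS](_ : _ = 0) ?sub0mx //.
  by apply/rowP => a; rewrite !mxE (negPf (join_seq_neq0 v_neq0 _)).
have [xj|xj] := eqVneq (mdeg (mon x)) j; last first.
  rewrite [X in (X <= _)%MS](_ : _ = 0) ?sub0mx //.
  apply: row_enumP => t; rewrite !mxE enum_rankK; case: eqP => // tx.
  by rewrite -zj taylor_degree_partE tx (negPf xj) mulr0.
have [||w wx dw] := acy x x0 xj
    (fun s : i.+1.-tuple A => if join_seq v s == x then z ord0 (enum_rank s) else 0).
- by move=> s /negPf ->.
(* For [i = 0] there is no cycle condition, but then [t] is empty and its join [\bot] is not [x]. *)
- move=> t tx; have [i0|i0] := posnP i.
    move: x0; rewrite -tx; have := size_tuple t; rewrite [in X in _ = X -> _]i0.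
    by move/size0nil => ->; rewrite /join_seq big_nil eqxx.
  rewrite -[RHS](zd t i0); apply: eq_bigr => s _; rewrite tx.
  by case: eqP; rewrite ?mulr1 // !mulr0 mul0r.
apply/submxP; exists (\row_(a < #|{: i.+2.-tuple A}|) w (enum_val a)); rewrite mulmxA.
apply: row_enumP => t; rewrite taylor_dif_kE mxE enum_rankK.
under eq_bigr => s _ do rewrite taylor_degree_partE mxE enum_rankK.
case: eqP => [tx|tx].
  have /= := dw t tx; rewrite tx eqxx => <-; apply: eq_bigr => s _.
  have [sx|/wx ->] := eqVneq (join_seq v s) x; last by rewrite !mul0r.
  by rewrite sx xj eqxx !mulr1.
rewrite big1 // => s _; have [sx|/wx ->] := eqVneq (join_seq v s) x;
  last by rewrite !mul0r.
by rewrite sx [x == _]eq_sym (introF eqP tx) !mulr0.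
Qed.

End TaylorTor.

(** * Meet-irreducible elements and the exponents of M(L) *)

Section MeetIrreducibles.
Context {disp : Order.disp_t} (L : finTBLatticeType disp).
Implicit Types x y z l : L.

Lemma set_minimal (U : {set L}) x : x \in U ->
  exists2 y, y \in U & forall z, z \in U -> ~~ (z < y)%O.
Proof.
move=> Ux; pose h (y : L) := #|[set z | (z <= y)%O]|.
have [y Uy ymin] := arg_minnP h Ux; exists y => // z Uz; apply/negP => zy.
have /= := ymin z Uz; rewrite leqNgt => /negP; apply; apply: proper_card.
apply/properP; split; last by exists y; rewrite !inE ?lexx // lt_geF.
by apply/subsetP => u; rewrite !inE => /le_trans; apply; apply: ltW.
Qed.

Lemma lt_covers x z : (x < z)%O -> exists2 y, covers x y & (y <= z)%O.
Proof.
move=> xz; have Uz : z \in [set u | (x < u <= z)%O] by rewrite inE xz lexx.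
have [y] := set_minimal Uz; rewrite inE => /andP[xy yz] ymin; exists y => //.
rewrite /covers xy /=; apply/forallP => u; apply/negP => /andP[xu uy].
by have := ymin u; rewrite inE xu (ltW (lt_le_trans uy yz)) uy => /(_ isT).
Qed.

Lemma mi_cover l : l \in mi L ->
  exists2 c, (l < c)%O & forall z, (l < z)%O -> (c <= z)%O.
Proof.
rewrite inE => /and3P[_ _ /cards1P[c cE]]; exists c.
  by have := set11 c; rewrite -cE inE => /andP[].
move=> z /lt_covers[y ly yz].
by have : y \in [set c]; [rewrite -cE inE | rewrite inE => /eqP <-].
Qed.

(** Take [l] maximal among the elements above [y] but not above [x]. Everything strictly above [l]
    is above [x], so the join of [l] and [x] is its only cover. *)
Lemma mi_separates x y : y != \bot%O -> ~~ (x <= y)%O ->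
  exists2 l, l \in mi L & (y <= l)%O && ~~ (x <= l)%O.
Proof.
move=> y0 xy; have Uy : y \in [set z | (y <= z)%O && ~~ (x <= z)%O].
  by rewrite inE lexx.
have [l] := set_maximal Uy; rewrite inE => /andP[yl xl] lmax.
exists l; last by rewrite yl.
have ltx z : (l < z)%O -> (x <= z)%O.
  move=> lz; apply: contraTT isT => xz; have := lmax z.
  by rewrite inE (le_trans yl (ltW lz)) xz lz => /(_ isT).
have l_lx : (l < l `|` x)%O.
  rewrite lt_neqAle leUl andbT; apply: contraNneq xl => ->; exact: leUr.
rewrite inE; apply/and3P; split.
- by apply: contraNneq y0 => l0; rewrite -lex0 -l0.
- by apply: contraNneq xl => ->; rewrite lex1.
apply/cards1P; exists (l `|` x)%O; apply/setP => z; rewrite !inE.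
apply/idP/eqP => [/andP[lz /forallP/(_ (l `|` x)%O)]|->].
  rewrite l_lx /= => nlt; apply/esym/eqP; rewrite eq_le leUx (ltW lz) ltx //=.
  by move: nlt; rewrite lt_neqAle leUx (ltW lz) ltx // !andbT negbK => /eqP <-.
rewrite /covers l_lx; apply/forallP => u; apply/negP => /andP[lu].
by apply/negP; rewrite le_gtF // leUx (ltW lu) ltx.
Qed.

(** The exponent vector of [xmon]; its [mdeg] is the number e(x) of the opening comment. *)
Definition mi_exponent x : 'X_{1..#|mi L|} :=
  [multinom ~~ (x <= enum_val i)%O : nat | i < #|mi L|].

Lemma xmonE (k : fieldType) x : xmon k x = 'X_[mi_exponent x].
Proof.
rewrite /xmon -(big_morph _ (mpolyXD k) (mpolyX0 _ k)); congr 'X_[_].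
apply/mnmP => i; rewrite mnm_sumE mnmE.
under eq_bigr => j _ do rewrite mnm1E.
rewrite big_mkcond /= (bigD1 i) //= eqxx big1 => [|j /negPf ->].
  by rewrite addn0; case: ifP.
by rewrite if_same.
Qed.

Lemma mi_exponentU x y :
  mi_exponent (x `|` y)%O = mlcm (mi_exponent x) (mi_exponent y).
Proof.
by apply/mnmP => i; rewrite !mnmE leUx; case: (x <= _)%O; case: (y <= _)%O.
Qed.

Lemma mi_exponent0 : mi_exponent \bot%O = 0%MM.
Proof. by apply/mnmP => i; rewrite mnmE mnm0E le0x. Qed.

(** A separating meet-irreducible would be a variable of the first monomial only. This breaks down
    at [y = \bot]: in the two-element lattice [mi L] is empty and both exponents are 0. *)
Lemma mi_exponent_le x y : y != \bot%O ->
  (mi_exponent x <= mi_exponent y)%MM -> (x <= y)%O.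
Proof.
move=> y0 /mnm_lepP xy; apply: contraT => /(mi_separates y0)[l lmi /andP[yl xl]].
have := xy (enum_rank_in lmi l); rewrite !mnmE enum_rankK_in //.
by rewrite yl xl.
Qed.

Lemma mi_exponent_inj x y : x != \bot%O -> y != \bot%O ->
  mi_exponent x = mi_exponent y -> x = y.
Proof.
move=> x0 y0 xy; apply/eqP.
by rewrite eq_le !mi_exponent_le ?xy ?lepm_refl.
Qed.

Section Embedding.
Variables (n : nat) (f : L -> 'X_{1..n}).
Hypothesis f_le : forall x y, (f x <= f y)%MM = (x <= y)%O.
Hypothesis fU : forall x y, f (x `|` y)%O = mlcm (f x) (f y).

(* If [f x = f y + U_(v)], then every meet-irreducible [l >= y] with [~ x <= l]
   has [f l v = f y v]. Were [l < l `|` l'] for another such [l'], the unique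
   cover [c] of [l] would lie below both [l `|` l'] and [l `|` x], which bounds
   [f c] by [f l] at [v] and away from [v] respectively. *)
Lemma mi_exponent_step x y : y != \bot%O -> (y <= x)%O ->
  mdeg (f x) = (mdeg (f y)).+1 ->
  mdeg (mi_exponent x) = (mdeg (mi_exponent y)).+1.
Proof.
move=> y0 yx dxy; have fyx : (f y <= f x)%MM by rewrite f_le.
have /mdeg1P[v /eqP fv] : mdeg (f x - f y)%MM == 1%N.
  by rewrite mdeg_sub // dxy subSnn.
have fxE : f x = (U_(v) + f y)%MM by rewrite -fv submK.
have nxy : ~~ (x <= y)%O.
  by apply/negP => xy; move: dxy; rewrite (@le_anti _ _ x y) ?xy ?yx // => /n_Sn.
pose sep l := (y <= l)%O && ~~ (x <= l)%O.
have fl l : sep l -> f l v = f y v.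
  rewrite /sep -!f_le => /andP[/mnm_lepP yl xl]; apply/eqP; rewrite eqn_leq yl andbT.
  rewrite leqNgt; apply: contra xl => lv; apply/mnm_lepP => i.
  rewrite fxE mnmDE mnm1E; have [<- //|_] := eqVneq v i; exact: yl.
have sep_le l l' : l \in mi L -> sep l -> sep l' -> (l' <= l)%O.
  move=> /mi_cover[c lc cmin] sl sl'; apply: contraT => l'l.
  have cll' : (c <= l `|` l')%O.
    apply: cmin; rewrite lt_neqAle leUl andbT; apply: contraNneq l'l => ->.
    exact: leUr.
  have clx : (c <= l `|` x)%O.
    apply: cmin; rewrite lt_neqAle leUl andbT; case/andP: sl => _.
    by apply: contraNneq => ->; exact: leUr.
  have := lt_geF lc; rewrite -f_le => /negP[]; apply/mnm_lepP => i.
  have [<-|vi] := eqVneq v i.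
    move: cll'; rewrite -f_le fU => /mnm_lepP/(_ v).
    by rewrite mnmE (fl l) // (fl l') // maxnn.
  move: clx; rewrite -f_le fU => /mnm_lepP/(_ i).
  rewrite mnmE fxE mnmDE mnm1E (negPf vi) add0n.
  case/andP: sl; rewrite -f_le => /mnm_lepP/(_ i) yl _.
  by rewrite (maxn_idPl yl).
have [l0 l0mi sl0] := mi_separates y0 nxy.
(* Applied both ways, [sep_le] makes [l0] the only separating meet-irreducible. *)
have expE i : mi_exponent x i = (mi_exponent y i + (i == enum_rank_in l0mi l0))%N.
  have <- : sep (enum_val i) = (i == enum_rank_in l0mi l0).
    apply/idP/eqP => [si|->]; last by rewrite enum_rankK_in.
    apply: enum_val_inj; rewrite enum_rankK_in //; apply: le_anti.
    by rewrite !sep_le // enum_valP.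
  rewrite !mnmE /sep; have [xi|nxi] := boolP (x <= enum_val i)%O.
    by rewrite (le_trans yx xi).
  by case: (y <= _)%O.
rewrite !mdegE (eq_bigr _ (fun i _ => expE i)) big_split /= -addn1; congr addn.
by rewrite (bigD1 (enum_rank_in l0mi l0)) //= eqxx big1 // => i /negPf ->.
Qed.

End Embedding.
End MeetIrreducibles.

(** * Ideal spans and minimal monomial generators *)

Section MonomialIdeals.
Variables (k : fieldType) (n : nat).
Implicit Types (I G H : {mpoly k[n]} -> Prop).

Lemma ideal_span_incl G q : G q -> ideal_span G q.
Proof.
move=> Gq; exists [:: (1, q)]; rewrite big_seq1 mul1r; split=> // c.
by rewrite inE => /eqP ->.
Qed.

Lemma ideal_span_mul G p q : ideal_span G q -> ideal_span G (p * q).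
Proof.
move=> [s [sG ->]]; exists [seq (p * c.1, c.2) | c <- s].
split=> [c /mapP[d /sG Gd ->] //|].
by rewrite big_map mulr_sumr; apply: eq_bigr => c _; rewrite mulrA.
Qed.

Lemma ideal_span_trans G H p :
  (forall q, G q -> ideal_span H q) -> ideal_span G p -> ideal_span H p.
Proof.
move=> GH [s [sG ->]] {p}; elim: s sG => [|c s IHs] sG.
  by exists [::]; rewrite !big_nil.
have [t [tH tE]] := IHs (fun d sd => sG d (mem_behead (s := c :: s) sd)).
have [u [uH uE]] := ideal_span_mul c.1 (GH _ (sG c (mem_head _ _))).
exists (u ++ t); rewrite big_cat big_cons -tE -uE; split=> // d.
by rewrite mem_cat => /orP[/uH|/tH].
Qed.

(** Descent on the degree. Membership in [I] is an arbitrary proposition, hence the classical case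
    split. *)
Lemma min_monomial_gen_below I m : I 'X_[m] ->
  exists2 m0, (m0 <= m)%MM & min_monomial_gen I m0.
Proof.
have [d] := ubnP (mdeg m); elim: d m => // d IHd m ltmd Im.
have [ming|nming] := Classical_Prop.classic (min_monomial_gen I m).
  by exists m => //; apply: lepm_refl.
have [m1 m1m [Im1 m1_neq]] : exists2 m1, (m1 <= m)%MM & I 'X_[m1] /\ m1 <> m.
  apply: Classical_Prop.NNPP => none; apply: nming; split=> // m1 m1m Im1.
  by apply: Classical_Prop.NNPP => m1_neq; apply: none; exists m1.
have [|m0 m0m1 gm0] := IHd m1 _ Im1; last first.
  by exists m0 => //; apply: lepm_trans m1m.
rewrite -ltnS; apply: leq_trans ltmd; rewrite ltnS ltn_neqAle mdeg_le // andbT.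
apply/eqP => dm; apply: m1_neq; have /eqP := mdeg_sub m1m.
by rewrite dm subnn mdeg_eq0 => /eqP mm1; rewrite -(submK m1m) mm1 add0m.
Qed.

End MonomialIdeals.

(** * The lattice [L] with its atoms as generators *)

Section Transfer.
Variables (k : fieldType).
Context {disp : Order.disp_t} (L : finTBLatticeType disp).

Definition atom_type := {a : L | atom a}.

Let A : finType := atom_type.
Let v (a : A) : L := val a.

Lemma atom_neq0 (a : A) : v a != \bot%O.
Proof. by rewrite -lt0x; have /andP[] := valP a. Qed.

Lemma atom_le (a b : A) : (v a <= v b)%O -> a = b.
Proof.
move=> ab; apply: val_inj; apply/eqP; rewrite eq_le ab /=.
have /andP[_ /forallP/(_ (v a))] := valP b; rewrite lt0x atom_neq0 /=.
by rewrite lt_neqAle ab andbT negbK => /eqP <-.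
Qed.

Lemma atom_below x : x != \bot%O -> exists a : A, (v a <= x)%O.
Proof. by rewrite -lt0x => /lt_covers[a aa ax]; exists (Sub a aa). Qed.

Lemma label_join n (f : L -> 'X_{1..n}) : f \bot%O = 0%MM ->
  (forall x y, f (x `|` y)%O = mlcm (f x) (f y)) ->
  forall s, label (fun a => f (v a)) s = f (join_seq v s).
Proof.
move=> f0 fU; rewrite /label /join_seq; elim=> [|a s IHs].
  by rewrite !big_nil.
by rewrite !big_cons IHs fU.
Qed.

(** * Acyclicity in the degrees of M(L), from linearity of [I] *)

Section LinearLCM.
Variables (n : nat) (f : L -> 'X_{1..n}) (d : nat).
Hypothesis f_le : forall x y, (f x <= f y)%MM = (x <= y)%O.
Hypothesis fU : forall x y, f (x `|` y)%O = mlcm (f x) (f y).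
Hypothesis f_acyclic : forall p x, x != \bot%O ->
  mdeg (f x) <> (p + d)%N -> relative_acyclic k v p x.

Lemma mdeg_atom a : mdeg (f (v a)) = d.
Proof.
apply/eqP; apply/negPn/negP => /eqP fa.
apply: (not_relative_acyclic0 (k := k) atom_neq0 (a := a) atom_le).
exact: (f_acyclic (p := 0%N) (atom_neq0 a)).
Qed.

Lemma mi_exponent_atom a b : mdeg (mi_exponent (v a)) = mdeg (mi_exponent (v b)).
Proof.
have [N] := ubnP #|[set z | (z <= v a `|` v b)%O]|.
elim: N a b => // N IHN a b ltN; apply/eqP/negPn/negP => ab.
set x := (v a `|` v b)%O in ltN.
have xv c : v c != x.
  apply: contra ab => /eqP cx.
  have -> : a = c by apply: atom_le; rewrite cx; apply: leUl.
  have -> : b = c by apply: atom_le; rewrite cx; apply: leUr.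
  exact: eqxx.
have x0 : x != \bot%O.
  by apply: contra (atom_neq0 a) => /eqP x0; rewrite -lex0 -x0 leUl.
(* An indicator rather than the degree itself, since distinct degrees may agree in [k] when the
   characteristic is positive. *)
pose phi c : k := (mdeg (mi_exponent (v c)) == mdeg (mi_exponent (v a)))%:R.
have nacy : ~ relative_acyclic k v 1 x.
  apply: (not_relative_acyclic1 (phi := phi) xv (a := a) (b := b)) => //.
    by rewrite /phi eqxx (eq_sym (mdeg _) (mdeg _)) (negPf ab) oner_neq0.
  move=> c e cex; rewrite /phi (IHN c e) //; rewrite ltnS in ltN; apply: leq_trans ltN.
  apply: proper_card; apply/properP; split.
    by apply/subsetP => z; rewrite !inE => /le_trans; apply; apply: ltW.
  by exists x; rewrite !inE ?lexx // lt_geF.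
have fx : mdeg (f x) = d.+1.
  apply/eqP/negPn/negP => /eqP fx; apply: nacy; apply: f_acyclic => //.
case/eqP: ab; apply: succn_inj.
rewrite -!(mi_exponent_step f_le fU (x := x)) ?atom_neq0 ?mdeg_atom ?leUl //.
exact: leUr.
Qed.

(** Induction on [p]; for [p = 0] only atoms carry chains. In the step [f x] may be assumed of
    degree [p.+1 + d], and every [y] below [x] is acyclic in degree [p]: by [f_acyclic] if [f y] has
    degree other than [p + d], else by induction through [mi_exponent_step]. *)
Lemma mi_exponent_acyclic a0 p x : x != \bot%O ->
  mdeg (mi_exponent x) <> (p + mdeg (mi_exponent (v a0)))%N ->
  relative_acyclic k v p x.
Proof.
elim: p x => [|p IHp] x x0 dx.
  apply: relative_acyclic0 => a; apply/eqP => ax; apply: dx.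
  by rewrite -ax (mi_exponent_atom a a0).
have [fx|/eqP fx] := eqVneq (mdeg (f x)) (p.+1 + d)%N; last exact: f_acyclic.
apply: relative_acyclicS; first exact: atom_neq0.
move=> y yx y0; have [fy|/eqP fy] := eqVneq (mdeg (f y)) (p + d)%N.
  apply: IHp => // dy; apply: dx.
  by rewrite (mi_exponent_step f_le fU y0 (ltW yx)) ?dy ?fx ?fy.
exact: f_acyclic.
Qed.

End LinearLCM.

Lemma minimal_idealE p : @minimal_ideal disp L k p <->
  ideal_span (fun q => exists a : A, q = 'X_[mi_exponent (v a)]) p.
Proof.
split; apply: ideal_span_trans => q.
  move=> [a aa ->]; apply: ideal_span_incl; exists (Sub a aa).
  by rewrite xmonE.
by move=> [a ->]; apply: ideal_span_incl; exists (v a); rewrite ?xmonE ?(valP a).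
Qed.

(** * The atoms of [L] as the minimal generators of [I] *)

Section LCMLattice.
Variables (n : nat) (I : {mpoly k[n]} -> Prop) (f : L -> 'X_{1..n}).
Hypothesis monI : is_monomial_ideal I.
Hypothesis f_le : forall x y, (f x <= f y)%MM = (x <= y)%O.
Hypothesis f_LCM : forall m, LCM I m <-> exists x, f x = m.
Hypothesis L_neq0 : (\bot : L)%O != \top%O.

Lemma lcm_embedding_bot : f \bot%O = 0%MM.
Proof.
have [x fx] : exists x, f x = 0%MM.
  by apply/f_LCM; exists [::]; rewrite big_nil.
have /mnm_lepP x0 : (f \bot%O <= f x)%MM by rewrite f_le le0x.
apply/mnmP => i; apply/eqP; rewrite mnm0E -leqn0 (leq_trans (x0 i)) //.
by rewrite fx mnm0E.
Qed.

Lemma lcm_embedding_inj x y : f x = f y -> x = y.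
Proof. by move=> fxy; apply/eqP; rewrite eq_le -!f_le fxy !lepm_refl. Qed.

(** LCM(I) is closed under lcm, so the right side is [f z] for some [z]; being above [x] and [y],
    [z] is above their join. *)
Lemma lcm_embedding_join x y : f (x `|` y)%O = mlcm (f x) (f y).
Proof.
have [s1 [s1g s1E]] : LCM I (f x) by apply/f_LCM; exists x.
have [s2 [s2g s2E]] : LCM I (f y) by apply/f_LCM; exists y.
have assoc : associative (@mlcm n).
  by move=> a b c; apply/mnmP => i; rewrite !mnmE maxnA.
have [z fz] : exists z, f z = mlcm (f x) (f y).
  apply/f_LCM; exists (s1 ++ s2); split.
    by move=> g; rewrite mem_cat => /orP[/s1g|/s2g].
  rewrite s1E s2E; elim: s1 {s1g s1E} => [|a s IHs] /=.
    by rewrite big_nil mlc0m.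
  by rewrite !big_cons -IHs assoc.
apply: lem_anti; last by rewrite lem_mlcm !f_le leUl leUr.
by rewrite -fz f_le leUx -!f_le fz lem_mlcml lem_mlcmr.
Qed.

(** [L_neq0] excludes the unit ideal: if 1 were a minimal generator it would be the only one, and
    LCM(I) would be trivial. *)
Lemma min_gen_embedding g : min_monomial_gen I g ->
  exists2 y, f y = g & y != \bot%O.
Proof.
move=> gI; have [y fy] : exists y, f y = g.
  apply/f_LCM; exists [:: g]; rewrite big_cons big_nil mlcm0; split=> // h.
  by rewrite inE => /eqP ->.
exists y => //; apply: contra L_neq0 => /eqP y0.
have g0 : g = 0%MM by rewrite -fy y0 lcm_embedding_bot.
apply/eqP/lcm_embedding_inj; rewrite lcm_embedding_bot.
have [s [sI ->]] : LCM I (f \top%O) by apply/f_LCM; exists \top%O.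
elim: s sI => [|h s IHs] sI; first by rewrite big_nil.
rewrite big_cons -IHs; last by move=> e se; apply: sI; rewrite inE se orbT.
have [_ /(_ 0%MM)] := sI h (mem_head _ _).
move=> <-; rewrite ?mlc0m //; last by rewrite -g0; case: gI.
by apply/mnm_lepP => i; rewrite mnm0E.
Qed.

Lemma atom_above_min_gen (a : A) :
  exists2 g, min_monomial_gen I g & (g <= f (v a))%MM.
Proof.
have [[|g s] [sI fa]] : LCM I (f (v a)) by apply/f_LCM; exists (v a).
  move: fa; rewrite big_nil -lcm_embedding_bot => /lcm_embedding_inj a0.
  by move: (atom_neq0 a); rewrite a0 eqxx.
exists g; first exact: sI (mem_head _ _).
by rewrite fa big_cons lem_mlcml.
Qed.

(** A minimal generator dividing [f (v a)] is [f y] with [y] below the atom and not [\bot], hence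
    [y = v a]. *)
Lemma atom_min_gen (a : A) : min_monomial_gen I (f (v a)).
Proof.
have [g gI ga] := atom_above_min_gen a; have [y fy y0] := min_gen_embedding gI.
have [b by_] := atom_below y0.
have yab : y = v a.
  apply: le_anti; rewrite -f_le fy ga /=.
  have <- : b = a by apply: atom_le; apply: le_trans by_ _; rewrite -f_le fy.
  exact: by_.
by rewrite -yab fy.
Qed.

Lemma min_gen_atom g : min_monomial_gen I g -> exists a : A, g = f (v a).
Proof.
move=> gI; have [y fy /atom_below[a ay]] := min_gen_embedding gI.
exists a; case: gI => _ /(_ (f (v a))) <- //; first by rewrite -fy f_le.
by case: (atom_min_gen a).
Qed.

Lemma monomial_ideal_atoms p :
  I p <-> ideal_span (fun q => exists a : A, q = 'X_[f (v a)]) p.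
Proof.
have [B IB] := monI; split; last first.
  move=> ap; apply/IB; apply: ideal_span_trans ap => q [a ->]; apply/IB.
  by case: (atom_min_gen a).
move/IB; apply: ideal_span_trans => _ [m Bm ->].
have /min_monomial_gen_below[m0 m0m /min_gen_atom[a am0]] : I 'X_[m].
  by apply/IB; apply: ideal_span_incl; exists m.
rewrite -(submK m0m) mpolyXD; apply: ideal_span_mul; apply: ideal_span_incl.
by exists a; rewrite am0.
Qed.

End LCMLattice.
End Transfer.

Theorem theorem5p2 (k : fieldType) (n : nat) (I : {mpoly k[n]} -> Prop)
    (disp : Order.disp_t) (L : finTBLatticeType disp) :
  is_monomial_ideal I -> is_atomic L -> isomorphic_to_LCM L I ->
  has_linear_resolution I -> has_linear_resolution (@minimal_ideal disp L k).
Proof.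
move=> monI _ [f [f_le f_LCM]] [d linI].
pose g (a : atom_type L) := mi_exponent (val a).
have resM := taylor_resolution (@minimal_idealE k _ L).
have lab := label_join (mi_exponent0 L) (@mi_exponentU _ L).
suff [d' acy] : exists d', forall p (x : L), x != \bot%O ->
    mdeg (mi_exponent x) <> (p + d')%N ->
    relative_acyclic k (fun a : atom_type L => val a) p x.
  exists d' => i j ij; exists (taylor k g) => //.
  apply/eqP; rewrite subn_eq0; apply: mxrankS.
  apply: (tor_of_relative_acyclic (@atom_neq0 _ L) lab (@mi_exponent_inj _ L)).
  by move=> x x0 xj; apply: acy => //; apply/eqP; rewrite xj.
(* For the zero and the unit ideal the lattice has one element, so no [x != \bot] exists and any
   [d'] serves. *)
have [L0|L_neq0] := eqVneq (\bot : L)%O \top%O.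
  by exists 0%N => p x /eqP[]; apply: le_anti; rewrite le0x L0 lex1.
have f0 := lcm_embedding_bot f_le f_LCM.
have fU := lcm_embedding_join f_le f_LCM.
have resI := taylor_resolution (monomial_ideal_atoms monI f_le f_LCM L_neq0).
have f_acyclic p x : x != \bot%O -> mdeg (f x) <> (p + d)%N ->
    relative_acyclic k (fun a : atom_type L => val a) p x.
  (* [linI] may give a different [F] for each pair of degrees; [tor_transfer] moves all the
     vanishing to the one Taylor resolution. *)
  move=> x0 /eqP fx; have [F resF tF] := linI _ _ fx.
  apply: (relative_acyclic_of_tor (@atom_neq0 _ L) (label_join f0 fU)) => //.
    by move=> y z _ _; apply: lcm_embedding_inj.
  exact (tor_transfer resF resI tF).
(* The generators of M(L) share one degree, so an arbitrary atom supplies the shift [d']. *)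
have [a0 _] := atom_below (x := \top%O : L) (contra_neq esym L_neq0).
exists (mdeg (mi_exponent (val a0))) => p x.
exact: (mi_exponent_acyclic f_le fU f_acyclic).
Qed.
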